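(* Let $E_0\subset\mathbb{R}^2$ be an ellipse which is not a circle, with equation $Ax^2+Bxy+Cy^2+Dx+Ey+F=0$, where $A,C>0$. Let $\theta$ denote the counterclockwise angle of rotation to the major axis of $E_0$ from the line through the center of $E_0$ and parallel to the $x$ axis, with $0\le\theta<\pi$. Let $r=\sqrt{(A-C)^2+B^2}$. Then: (i) $$\theta=\begin{cases}(1+\operatorname{sgn}B)\dfrac{\pi}{4}+\dfrac12\cot^{-1}\left(\dfrac{A-C}{B}\right) & \text{if } B\neq 0,\\[2mm] \bigl(1+\operatorname{sgn}(A-C)\bigr)\dfrac{\pi}{4} & \text{if } B=0.\end{cases}$$ (ii) $\tan\theta=\dfrac{B}{A-C-r}$ if either $B\neq 0$, or $B=0$ and $A<C$.
   Context: $\operatorname{sgn}$ denotes the sign function ($\operatorname{sgn}t=1$ for $t>0$, $-1$ for $t<0$, $0$ for $t=0$). The inverse cotangent is taken with the convention $0\le\cot^{-1}x<\pi$, i.e. $\cot^{-1}x$ is the unique angle in $(0,\pi)$ whose cotangent is $x$. The coefficients $A,B,C,D,E,F$ are real. Saying that an equation is the equation of $E_0$ means that $E_0$ is exactly the set of points $(x,y)\in\mathbb{R}^2$ satisfying it. The angle $\theta\in[0,\pi)$ is the one for which the major axis of $E_0$ has direction $(\cos\theta,\sin\theta)$. *)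

(* Defs.v *)
From Stdlib Require Export Reals.
From Stdlib Require Import Lra.
From Coquelicot Require Export Rcomplements.
Open Scope R_scope.

Definition point : Type := (R * R)%type.

Definition pdist (p q : point) : R := dist_euc (fst p) (snd p) (fst q) (snd q).

(* The case [f1 = f2] is allowed: circles are ellipses. The strict inequality
   excludes the empty set and line segments. *)
Definition ellipse_with_foci (S : point -> Prop) (f1 f2 : point) (a : R) : Prop :=
  pdist f1 f2 < 2 * a /\
  forall p : point, S p <-> pdist p f1 + pdist p f2 = 2 * a.

Definition is_ellipse (S : point -> Prop) : Prop :=
  exists (f1 f2 : point) (a : R), ellipse_with_foci S f1 f2 a.

Definition is_circle (S : point -> Prop) : Prop :=
  exists (c : point) (rho : R),
    0 < rho /\ forall p : point, S p <-> pdist p c = rho.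

Definition on_line (c v p : point) : Prop :=
  exists t : R, p = (fst c + t * fst v, snd c + t * snd v).

Definition has_direction (L : point -> Prop) (v : point) : Prop :=
  exists c : point, forall p : point, L p <-> on_line c v p.

(* The major axis is the line through the two distinct foci. *)
Definition is_major_axis (S L : point -> Prop) : Prop :=
  exists (f1 f2 : point) (a : R),
    ellipse_with_foci S f1 f2 a /\ f1 <> f2 /\
    forall p : point,
      L p <-> on_line f1 (fst f2 - fst f1, snd f2 - snd f1) p.

Lemma acot_exists (x : R) :
  {y : R | unique (fun z => 0 < z < PI /\ cos z / sin z = x) y}.
Proof.
exists (PI / 2 - atan x).
pose proof (atan_bound x) as Hb.
split.
- split; [lra|].
  rewrite cos_shift, sin_shift.
  exact (tan_atan x).
- intros z [Hz Hx].
  assert (Ht : tan (PI / 2 - z) = x).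
  { unfold tan. rewrite cos_shift, sin_shift. exact Hx. }
  rewrite <- Ht, atan_tan; lra.
Qed.

(* Inverse cotangent with values in (0, PI). *)
Definition acot (x : R) : R := proj1_sig (acot_exists x).

(* Main.v *)
(** Let [m] be the centre of [E0], [e = (cos theta, sin theta)] and [e'] its
    rotation by a right angle, and let [a], [b] be the semi-axes, so that
    [0 < b < a]. In the coordinates of the frame [(m, e, e')] the quadratic form
    becomes [A' x^2 + B' x y + C' y^2] and vanishes, together with its lower order
    terms, at all points [(a c, b s)] with [c^2 + s^2 = 1]. Hence [B' = 0] and
    [A' a^2 = C' b^2], and since [A' + C' = A + C > 0] this gives [A' < C'].
    With [k = C' - A'] this reads
    [A - C = - k cos (2 theta)] and [B = - k sin (2 theta)], [k > 0],
    which determines [theta]; moreover [k = r]. *)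

Require Import Defs.
From Stdlib Require Import Reals Lra Psatz.
From Coquelicot Require Import Rcomplements.
Open Scope R_scope.

(** The distances from this point to the two foci are [a + s * c1] and [a - s * c1]. Both are
    nonnegative because [s * c1] lies between [- a] and [a], and they add up to [2 * a]. *)
Lemma ellipse_with_foci_parametrization (S : point -> Prop)
    (m1 m2 u v s a b c1 s1 : R) :
  u ^ 2 + v ^ 2 = 1 ->
  ellipse_with_foci S (m1 - s * u, m2 - s * v) (m1 + s * u, m2 + s * v) a ->
  s ^ 2 < a ^ 2 -> 0 < a -> b ^ 2 = a ^ 2 - s ^ 2 -> c1 ^ 2 + s1 ^ 2 = 1 ->
  S (m1 + a * c1 * u - b * s1 * v, m2 + a * c1 * v + b * s1 * u).
Proof.
intros Huv [_ HS] Hsa Ha Hb Hc.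
apply HS; unfold pdist, dist_euc; simpl fst; simpl snd.
assert (Hbound : - a <= s * c1 <= a).
{ assert (H : (s * c1) ^ 2 <= a ^ 2).
  { pose proof (pow2_ge_0 s1). pose proof (pow2_ge_0 s). nra. }
  split; nra. }
assert (Hs1 : s1 ^ 2 = 1 - c1 ^ 2) by lra.
(* In the frame of the axes the squared distance to a focus is a perfect square; [d = s] and
   [d = - s] treat the two foci. *)
assert (Hdist : forall d, d ^ 2 = s ^ 2 ->
  (a * c1 + d) ^ 2 + (b * s1) ^ 2 = (a + d * c1) ^ 2).
{ intros d Hd.
  replace ((a * c1 + d) ^ 2 + (b * s1) ^ 2)
    with (a ^ 2 * c1 ^ 2 + 2 * a * c1 * d + d ^ 2 + b ^ 2 * s1 ^ 2) by ring.
  rewrite Hb, Hs1, <- Hd; ring. }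
replace (Rsqr (m1 + a * c1 * u - b * s1 * v - (m1 - s * u)) +
         Rsqr (m2 + a * c1 * v + b * s1 * u - (m2 - s * v)))
  with (Rsqr (a + s * c1)).
2:{ transitivity ((a + s * c1) ^ 2); [unfold Rsqr; ring|].
    (* The factor [1], written as [u ^ 2 + v ^ 2], turns the rotation invariance of the norm into a
       polynomial identity. *)
    rewrite <- (Hdist s eq_refl), <- (Rmult_1_r (_ + _)), <- Huv.
    unfold Rsqr; ring. }
replace (Rsqr (m1 + a * c1 * u - b * s1 * v - (m1 + s * u)) +
         Rsqr (m2 + a * c1 * v + b * s1 * u - (m2 + s * v)))
  with (Rsqr (a + - s * c1)).
2:{ transitivity ((a + - s * c1) ^ 2); [unfold Rsqr; ring|].
    rewrite <- (Hdist (- s)) by ring.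
    rewrite <- (Rmult_1_r (_ + _)), <- Huv.
    unfold Rsqr; ring. }
rewrite !sqrt_Rsqr by lra.
ring.
Qed.

(** Adding the equations at antipodal points cancels the linear terms. The four vertices give
    [A * a ^ 2 = - F = C * b ^ 2]; the rational pair on the unit circle then leaves only the mixed
    term. *)
Lemma conic_through_axis_parallel_ellipse (A B C D E F a b : R) :
  0 < a -> 0 < b ->
  (forall c s : R, c ^ 2 + s ^ 2 = 1 ->
     A * (a * c) ^ 2 + B * (a * c) * (b * s) + C * (b * s) ^ 2 +
     D * (a * c) + E * (b * s) + F = 0) ->
  B = 0 /\ A * a ^ 2 = C * b ^ 2.
Proof.
intros Ha Hb H.
pose proof (H 1 0 ltac:(lra)).
pose proof (H (-1) 0 ltac:(lra)).
pose proof (H 0 1 ltac:(lra)).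
pose proof (H 0 (-1) ltac:(lra)).
pose proof (H (3/5) (4/5) ltac:(lra)).
pose proof (H (-(3/5)) (-(4/5)) ltac:(lra)).
assert (HB : B * (a * b) = 0) by lra.
split; [|lra].
apply Rmult_integral in HB; destruct HB as [HB|HB]; [exact HB|nra].
Qed.

(** Writes the foci symmetrically about the centre along the given unit direction. The sign of [s]
    is left open, since the foci may come in either order. *)
Lemma major_axis_midpoint (S L : point -> Prop) (u v : R) :
  u ^ 2 + v ^ 2 = 1 -> is_major_axis S L -> has_direction L (u, v) ->
  exists m1 m2 s a : R,
    ellipse_with_foci S (m1 - s * u, m2 - s * v) (m1 + s * u, m2 + s * v) a /\
    s <> 0 /\ 0 < a /\ s ^ 2 < a ^ 2.
Proof.
intros Huv [[x1 y1] [[x2 y2] [a [HS [Hne HL]]]]] [[p q] Hdir].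
simpl in HL.
assert (H1 : on_line (p, q) (u, v) (x1, y1)).
{ apply Hdir, HL. exists 0; simpl; f_equal; ring. }
assert (H2 : on_line (p, q) (u, v) (x2, y2)).
{ apply Hdir, HL. exists 1; simpl; f_equal; ring. }
destruct H1 as [t1 H1]; destruct H2 as [t2 H2]; simpl in H1, H2.
rewrite H1, H2 in HS, Hne.
exists (p + (t1 + t2) / 2 * u), (q + (t1 + t2) / 2 * v), ((t2 - t1) / 2), a.
replace (p + (t1 + t2) / 2 * u - (t2 - t1) / 2 * u) with (p + t1 * u) by field.
replace (q + (t1 + t2) / 2 * v - (t2 - t1) / 2 * v) with (q + t1 * v) by field.
replace (p + (t1 + t2) / 2 * u + (t2 - t1) / 2 * u) with (p + t2 * u) by field.
replace (q + (t1 + t2) / 2 * v + (t2 - t1) / 2 * v) with (q + t2 * v) by field.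
split; [exact HS|split].
- intros H0; apply Hne; replace t2 with t1 by lra; reflexivity.
- destruct HS as [Hlt _]; unfold pdist, dist_euc in Hlt; simpl in Hlt.
  replace (Rsqr (p + t1 * u - (p + t2 * u)) + Rsqr (q + t1 * v - (q + t2 * v)))
    with (Rsqr (t2 - t1)) in Hlt.
  2:{ rewrite <- (Rmult_1_r (Rsqr (t2 - t1))), <- Huv; unfold Rsqr; ring. }
  rewrite sqrt_Rsqr_abs in Hlt.
  pose proof (Rabs_pos (t2 - t1)).
  pose proof (pow2_abs (t2 - t1)).
  split; nra.
Qed.

Lemma quadratic_part_polar (S : point -> Prop) (A B C D E F theta : R) :
  (forall x y : R,
     S (x, y) <-> A * x ^ 2 + B * x * y + C * y ^ 2 + D * x + E * y + F = 0) ->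
  0 < A + C ->
  (exists L : point -> Prop,
     is_major_axis S L /\ has_direction L (cos theta, sin theta)) ->
  exists k : R,
    0 < k /\ A - C = - k * cos (2 * theta) /\ B = - k * sin (2 * theta).
Proof.
intros Heq HAC [L [Hmaj Hdir]].
rewrite cos_2a, sin_2a.
assert (Huv : cos theta ^ 2 + sin theta ^ 2 = 1).
{ rewrite <- (sin2_cos2 theta); unfold Rsqr; ring. }
destruct (major_axis_midpoint S L _ _ Huv Hmaj Hdir)
  as [m1 [m2 [s [a [HS [Hs [Ha Hsa]]]]]]].
set (u := cos theta) in *; set (v := sin theta) in *.
pose (b := sqrt (a ^ 2 - s ^ 2)).
assert (Hb : 0 < b) by (apply sqrt_lt_R0; lra).
assert (Hb2 : b ^ 2 = a ^ 2 - s ^ 2) by (apply pow2_sqrt; lra).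
set (A' := A * u ^ 2 + B * u * v + C * v ^ 2).
set (C' := A * v ^ 2 - B * u * v + C * u ^ 2).
(* The six coefficients are those of the conic after substituting [x = m1 + X * u - Y * v] and
   [y = m2 + X * v + Y * u]. *)
destruct (conic_through_axis_parallel_ellipse A'
  (- 2 * A * u * v + B * (u ^ 2 - v ^ 2) + 2 * C * u * v) C'
  (2 * A * m1 * u + B * (m1 * v + m2 * u) + 2 * C * m2 * v + D * u + E * v)
  (- 2 * A * m1 * v + B * (m1 * u - m2 * v) + 2 * C * m2 * u - D * v + E * u)
  (A * m1 ^ 2 + B * m1 * m2 + C * m2 ^ 2 + D * m1 + E * m2 + F)
  a b Ha Hb) as [HB' Hab].
{ intros c1 s1 Hc.
  pose proof (proj1 (Heq _ _) (ellipse_with_foci_parametrization S m1 m2 u v s a b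
    c1 s1 Huv HS Hsa Ha Hb2 Hc)) as H.
  rewrite <- H; unfold A', C'; ring. }
assert (Hsum : A' + C' = A + C).
{ unfold A', C'; rewrite <- (Rmult_1_r (A + C)), <- Huv; ring. }
assert (Hs2 : 0 < s ^ 2) by (pose proof (pow2_gt_0 s Hs); lra).
exists (C' - A'); split; [|split].
- assert (HC' : 0 < C').
  { apply Rnot_le_lt; intros HC'.
    assert (0 < A') by lra.
    pose proof (pow_lt a 2 Ha); pose proof (pow_lt b 2 Hb); nra. }
  rewrite Hb2 in Hab.
  pose proof (pow_lt a 2 Ha); nra.
(* The rotation is inverted by adding a multiple of the vanishing mixed coefficient; the same is
   done for [B] below. *)
- transitivity ((A - C) * (u ^ 2 + v ^ 2) * (u ^ 2 + v ^ 2)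
    + 2 * u * v * (- 2 * A * u * v + B * (u ^ 2 - v ^ 2) + 2 * C * u * v)).
  + rewrite HB', Huv; ring.
  + unfold A', C'; ring.
- transitivity (B * (u ^ 2 + v ^ 2) * (u ^ 2 + v ^ 2)
    - (u ^ 2 - v ^ 2) * (- 2 * A * u * v + B * (u ^ 2 - v ^ 2) + 2 * C * u * v)).
  + rewrite HB', Huv; ring.
  + unfold A', C'; ring.
Qed.

Lemma acot_cot (z : R) : 0 < z < PI -> acot (cos z / sin z) = z.
Proof.
intros Hz; unfold acot.
destruct (acot_exists (cos z / sin z)) as [y [Hy Huniq]]; simpl.
apply Huniq; split; [exact Hz|reflexivity].
Qed.

Theorem theorem3 (E0 : point -> Prop) (A B C D E F theta : R)
  (hellipse : is_ellipse E0)
  (hnotcircle : ~ is_circle E0)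
  (hequation : forall x y : R,
     E0 (x, y) <-> A * x ^ 2 + B * x * y + C * y ^ 2 + D * x + E * y + F = 0)
  (hA : 0 < A) (hC : 0 < C)
  (htheta : 0 <= theta < PI)
  (haxis : exists L : point -> Prop,
     is_major_axis E0 L /\ has_direction L (cos theta, sin theta)) :
  let r := sqrt ((A - C) ^ 2 + B ^ 2) in
  ((B <> 0 ->
      theta = (1 + sign B) * (PI / 4) + 1 / 2 * acot ((A - C) / B)) /\
   (B = 0 ->
      theta = (1 + sign (A - C)) * (PI / 4))) /\
  (B <> 0 \/ (B = 0 /\ A < C) ->
     tan theta = B / (A - C - r)).
Proof.
intros r.
destruct (quadratic_part_polar E0 A B C D E F theta hequation ltac:(lra) haxis)
  as [k [Hk [HAC HB]]].
assert (Hpi : theta = 0 \/ 0 < theta < PI / 2 \/ theta = PI / 2 \/ PI / 2 < theta)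
  by lra.
assert (Hr : r = k).
{ unfold r; rewrite HAC, HB.
  replace ((- k * cos (2 * theta)) ^ 2 + (- k * sin (2 * theta)) ^ 2) with (Rsqr k).
  - apply sqrt_Rsqr; lra.
  - rewrite <- (Rmult_1_r (Rsqr k)), <- (sin2_cos2 (2 * theta)); unfold Rsqr; ring. }
split; [split|].
- intros HB0.
  destruct Hpi as [Ht|[Ht|[Ht|Ht]]].
  + exfalso; apply HB0; rewrite HB, Ht, Rmult_0_r, sin_0; ring.
  + assert (Hsin : 0 < sin (2 * theta)) by (apply sin_gt_0; lra).
    rewrite (sign_eq_m1 B) by nra.
    replace ((A - C) / B) with (cos (2 * theta) / sin (2 * theta))
      by (rewrite HAC, HB; field; lra).
    rewrite acot_cot by lra; lra.
  + exfalso; apply HB0; rewrite HB, Ht.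
    replace (2 * (PI / 2)) with PI by field; rewrite sin_PI; ring.
  (* Subtracting [PI] keeps the cotangent and brings the angle into the range of [acot]; the term
     with [sign B] restores the lost [PI / 2] in [theta]. *)
  + assert (Hsin : 0 < sin (2 * theta - PI)) by (apply sin_gt_0; lra).
    replace (2 * theta) with (2 * theta - PI + PI) in HAC, HB by ring.
    rewrite neg_cos in HAC; rewrite neg_sin in HB.
    rewrite (sign_eq_1 B) by nra.
    replace ((A - C) / B) with (cos (2 * theta - PI) / sin (2 * theta - PI))
      by (rewrite HAC, HB; field; lra).
    rewrite acot_cot by lra; lra.
- intros HB0.
  (* [B = 0] forces [sin (2 * theta) = 0], so only [0] and [PI / 2] survive. *)
  destruct Hpi as [Ht|[Ht|[Ht|Ht]]].
  + rewrite Ht, Rmult_0_r, cos_0 in HAC.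
    rewrite sign_eq_m1 by lra; lra.
  + assert (0 < sin (2 * theta)) by (apply sin_gt_0; lra); nra.
  + replace (2 * theta) with PI in HAC by lra; rewrite cos_PI in HAC.
    rewrite sign_eq_1 by lra; lra.
  + assert (sin (2 * theta) < 0) by (apply sin_lt_0; lra); nra.
- intros Hcase.
  (* A vertical major axis would give [B = 0] and [A - C = k > 0], against both cases. *)
  assert (Hcos : cos theta <> 0).
  { intros Hc; rewrite cos_2a_cos in HAC; rewrite sin_2a in HB.
    rewrite Hc in HAC, HB; lra. }
  (* By the double-angle formulas the quotient is [- 2 * k * sin theta * cos theta] over
     [- 2 * k * cos theta ^ 2]. *)
  rewrite Hr, HAC, HB, cos_2a_cos, sin_2a; unfold tan.
  field; split; [|exact Hcos].
  replace (- k * (2 * cos theta * cos theta - 1) - k) with (- (2 * k * cos theta ^ 2)) by ring.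
  pose proof (pow2_gt_0 _ Hcos); nra.
Qed.
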